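(* Fix a constant $\eta\in(0,1)$. Consider group testing with the i.i.d. Bernoulli test design with parameter $\nu$ chosen such that $(1-\frac{\nu}{k})^k=\frac12$, and suppose that $n\le(1-\eta)\log_2\binom{p}{k}$. Then, when $k=k(p)$ satisfies $k=o\big(p^{\frac{\eta}{1+\eta}}\big)$ as $p\to\infty$, for any decoder that outputs an estimate $\mathcal{I}\in\{0,1,\dots,p\}$ of a definite defective (with $0$ representing ''I don't know''), we have $$ \mathbb{P}[\mathcal{I}>0\cap\mathcal{I}\notin S]=0\ \implies\ \mathbb{P}[\mathcal{I}=0]\to1 $$ as $p\to\infty$.
   Context: Probabilistic (noiseless) group testing: there are $p$ items $\{1,\dots,p\}$, and the defective set $S$ is uniformly distributed over the $\binom{p}{k}$ subsets of $\{1,\dots,p\}$ of cardinality $k\ge1$. I.i.d. Bernoulli design: the test matrix $\mathbf{X}\in\{0,1\}^{n\times p}$ has i.i.d. Bernoulli$(\nu/k)$ entries, independent of $S$, where $X^{(i)}_j=1$ iff item $j$ is in test $i$. The outcomes are $\mathbf{Y}\in\{0,1\}^n$ with $Y^{(i)}=\bigvee_{j\in S}X^{(i)}_j$. A decoder computes $\mathcal{I}$ from $(\mathbf{X},\mathbf{Y})$ (and knowledge of $p,k$). The premise $\mathbb{P}[\mathcal{I}>0\cap\mathcal{I}\notin S]=0$ is required for each $p$ in the sequence. Probabilities are over $S$ and $\mathbf{X}$ (and any randomness of the decoder). *)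

(* Defs.v *)
From mathcomp Require Import all_boot all_order all_algebra.
From mathcomp Require Import all_classical all_reals all_analysis.
Import Order.TTheory GRing.Theory Num.Theory.
Import numFieldNormedType.Exports.

Set Implicit Arguments.
Unset Strict Implicit.
Unset Printing Implicit Defensive.

Local Open Scope ring_scope.

Definition log2 {R : realType} (x : R) : R := ln x / ln 2.

(* The p items are the elements of 'I_p; row i of a test matrix is test i. *)
Definition test_matrix (n p : nat) := 'M[bool]_(n, p).
Definition test_result (n : nat) := 'cV[bool]_n.

(* An estimate is an element of {0, ..., p}: 0 means "I don't know", and the
   positive value j.+1, that is lift ord0 j, designates the item j : 'I_p. *)
Definition estimate (p : nat) := 'I_p.+1.

Definition outcome (n p : nat) (K : {set 'I_p}) (X : test_matrix n p) :
    test_result n :=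
  \col_i \big[orb/false]_(j in K) X i j.

(* A possibly randomised decoder: decoder_pmf X Y is the law of the estimate
   given the matrix X and the results Y, so that any internal randomness is
   independent of the defective set given (X, Y). *)
Record decoder (R : realType) (n p : nat) := Decoder {
  decoder_pmf :> test_matrix n p -> test_result n -> estimate p -> R;
  decoder_ge0 : forall X Y i, 0 <= decoder_pmf X Y i;
  decoder_sum1 : forall X Y, \sum_i decoder_pmf X Y i = 1 }.

Definition defective_pmf {R : realType} (p k : nat) (K : {set 'I_p}) : R :=
  if #|K| == k then ('C(p, k)%:R)^-1 else 0.

Definition iid_bernoulli_pmf {R : realType} (q : R) (n p : nat)
    (X : test_matrix n p) : R :=
  \prod_i \prod_j bernoulli_pmf q (X i j).

Definition sample (n p : nat) : finType :=
  ({set 'I_p} * test_matrix n p * estimate p)%type.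

(* Joint law of the defective set, the test matrix and the estimate under the
   i.i.d. Bernoulli(nu / k) design; the set and the matrix are independent. *)
Definition group_testing_pmf {R : realType} (n p k : nat) (nu : R)
    (D : decoder R n p) (w : sample n p) : R :=
  let: (K, X, i) := w in
  defective_pmf k K * iid_bernoulli_pmf (nu / k%:R) X * D X (outcome K X) i.

Definition group_testing_prob {R : realType} (n p k : nat) (nu : R)
    (D : decoder R n p) (E : pred (sample n p)) : R :=
  \sum_(w | E w) group_testing_pmf k nu D w.

Definition false_claim (n p : nat) : pred (sample n p) :=
  fun w => let: (K, _, i) := w in
    (0 < i)%N && (i \notin [set lift ord0 j | j in K]%SET).

Definition dont_know (n p : nat) : pred (sample n p) :=
  fun w => w.2 == ord0.

(* Main.v *)
(* Given the defective set K and the design X, let N be the number of k-sets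
   disjoint from K that produce the same outcome as K.  A decoder that never
   makes a false claim must answer "I don't know" as soon as N > 0, since a
   claimed item has to lie both in K and in a set disjoint from K.

   With q = nu / k and u = 1 - q, a test is negative on a set A with probability
   u ^ #|A|, and u ^ k = 1/2.  Hence a k-set disjoint from K agrees with K on a
   test with probability 1/2, and two of them sharing l items both agree with K
   with probability u ^ (2 k - l).  By Chebyshev, P(N = 0) is at most
   E[z ^ L] - 1, where z = u ^ (- n) and L is the overlap of two uniform k-subsets
   of the p - k non-defective items.  Expanding z ^ L = (1 + (z - 1)) ^ L over the
   subsets of the overlap gives E[z ^ L] <= (1 + k (z - 1) / (p - k)) ^ k.

   Finally z ^ k = 2 ^ n <= C(p, k) ^ (1 - eta) <= (e p / k) ^ (k (1 - eta)), so
   k ^ 2 z / p <= e (k / p ^ (eta / (1 + eta))) ^ (1 + eta), which tends to 0. *)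
Require Import Defs.
From mathcomp Require Import all_boot all_order all_algebra.
From mathcomp Require Import all_classical all_reals all_analysis.
From mathcomp Require Import ring lra zify.
Import Order.TTheory GRing.Theory Num.Theory.
Import numFieldNormedType.Exports.
Local Open Scope classical_set_scope.
Local Open Scope ring_scope.

(** * Subsets of fixed size: inclusions and overlaps *)

Section SubsetCounting.
Import boot.fintype boot.finset.
Set Implicit Arguments.
Unset Strict Implicit.

(** Removing [A] is a bijection onto the subsets of [B :\: A] of size [k - #|A|]; its inverse is the
    union with [A]. *)
Lemma card_superset_draws (T : finType) (B A : {set T}) (k : nat) :
  A \subset B -> (#|A| <= k)%N ->
  #|[set S : {set T} | (S \subset B) && (#|S| == k) && (A \subset S)]%SET| =
  'C(#|B| - #|A|, k - #|A|).
Proof.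
move=> sAB leAk.
rewrite -[(#|B| - #|A|)%N](_ : #|B :\: A| = _); last by rewrite cardsD (setIidPr sAB).
rewrite -cards_draws.
rewrite -[RHS](card_in_imset (f := fun S => S :|: A)).
  apply: eq_card => S; rewrite inE; apply/idP/imsetP => [|[S']].
    move=> /andP[/andP[sSB /eqP cS] sAS]; exists (S :\: A).
      by rewrite inE setSD // cardsD (setIidPr sAS) cS eqxx.
    by rewrite setUC setDE setUIr setUCr setIT (setUidPr sAS).
  rewrite inE subsetD => /andP[/andP[sS'B dS'] /eqP cS'] ->.
  rewrite subsetUr andbT subUset sS'B sAB /=.
  by rewrite cardsU (eqP (_ : _ :&: _ == set0)) ?setI_eq0 // cards0 cS'; apply/eqP; lia.
move=> S1 S2; rewrite !inE !subsetD => /andP[/andP[_ d1] _] /andP[/andP[_ d2] _] e.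
have := congr1 (fun S => S :\: A) e.
rewrite !setDUl !setDv !setU0.
by move/setDidPl: d1 => ->; move/setDidPl: d2 => ->.
Qed.

Lemma sum_expr_card_subsets (R : comPzRingType) (T : finType) (B : {set T})
    (F : nat -> R) :
  \sum_(A : {set T} | A \subset B) F #|A| = \sum_(t < #|B|.+1) F t *+ 'C(#|B|, t).
Proof.
rewrite (partition_big (fun A : {set T} => inord #|A| : 'I_#|B|.+1) xpredT) //=.
apply: eq_bigr => i _; rewrite -cards_draws -sumr_const.
apply: eq_big => [A|A].
  rewrite inE; case sAB: (A \subset B) => //=.
  by rewrite -val_eqE /= inordK // ltnS subset_leq_card.
by case/andP=> sAB /eqP <-; rewrite inordK // ltnS subset_leq_card.
Qed.

Lemma expr_card_subsets (R : comPzRingType) (T : finType) (A : {set T}) (z : R) :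
  z ^+ #|A| = \sum_(B : {set T} | B \subset A) (z - 1) ^+ #|B|.
Proof.
rewrite -[in LHS](subrK 1 z) addrC exprDn (sum_expr_card_subsets _ (fun t => (z - 1) ^+ t)).
by apply: eq_bigr => i _; rewrite expr1n mul1r.
Qed.

(** The quotient of the two binomials is the product over [i < t] of [(k - i) / (m - i)], and each
    factor is at most [k / m]. *)
Lemma bin_sub_ratio (m k t : nat) :
  (t <= k <= m)%N -> ('C(m - t, k - t) * m ^ t <= 'C(m, k) * k ^ t)%N.
Proof.
elim: t => [|t IH] /andP[ltk lkm]; first by rewrite !subn0 !expn0 !muln1.
have {}IH := IH ltac:(lia).
rewrite !expnS.
have E : ((m - t) * 'C(m - t.+1, k - t.+1) = (k - t) * 'C(m - t, k - t))%N.
  have -> : (m - t.+1 = (m - t).-1)%N by lia.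
  have -> : (k - t = (k - t.+1).+1)%N by lia.
  by rewrite mul_bin_diag.
have H : ((k - t) * m <= k * (m - t))%N by nia.
rewrite -(@leq_pmul2l (m - t)%N) ?subn_gt0; last by lia.
rewrite mulnA E.
apply: (@leq_trans (((k - t) * m) * ('C(m - t, k - t) * m ^ t))%N); first by nia.
apply: (@leq_trans ((k * (m - t)) * ('C(m, k) * k ^ t))%N); last by nia.
exact: leq_mul.
Qed.

(** Both sides count the nested pairs of a [t]-set in a [k]-set inside a set of size [m]. *)
Lemma bin_mul_sub (m k t : nat) : (t <= k <= m)%N ->
  ('C(m, t) * 'C(m - t, k - t) = 'C(m, k) * 'C(k, t))%N.
Proof.
move=> /andP[tk km].
have f0 i : (0 < i`!)%N := fact_gt0 i.
have A := bin_fact (leq_trans tk km); have B := bin_fact km; have C := bin_fact tk.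
have D := bin_fact (leq_sub2r t km).
have E : (m - t - (k - t) = m - k)%N by lia.
rewrite E in D.
apply/eqP; rewrite -(@eqn_pmul2r (t`! * ((k - t)`! * (m - k)`!))) ?muln_gt0 ?f0 //.
apply/eqP; transitivity m`!.
  by rewrite -A -D; ring.
by rewrite -B -C; ring.
Qed.

(** Once expanded over the subsets [A] of the overlap, the sum gives [A] the weight
    [(z - 1) ^+ #|A|] times the square of the number of [k]-sets containing [A]. Of the two factors
    ['C(m - t, k - t)], one is absorbed by [bin_mul_sub] and the other bounded by [bin_sub_ratio];
    the binomial theorem then resums. *)
Lemma sum_expr_card_setI (R : realFieldType) (T : finType) (B : {set T}) (k : nat)
    (z : R) (P := [set S : {set T} | (S \subset B) & #|S| == k]%SET) :
  1 <= z -> (0 < k <= #|B|)%N ->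
  \sum_(S in P) \sum_(S' in P) z ^+ #|S :&: S'| <=
    'C(#|B|, k)%:R ^+ 2 * (1 + k%:R / #|B|%:R * (z - 1)) ^+ k.
Proof.
move=> z1 /andP[k0 km]; set m := #|B| in km *.
have m0 : 0 < m%:R :> R by rewrite ltr0n; lia.
pose c (A : {set T}) : R := \sum_(S in P) (A \subset S)%:R.
have -> : \sum_(S in P) \sum_(S' in P) z ^+ #|S :&: S'| =
    \sum_(A : {set T} | A \subset B) (z - 1) ^+ #|A| * c A ^+ 2.
  transitivity (\sum_(S in P) \sum_(S' in P) \sum_(A : {set T} | A \subset B)
      (z - 1) ^+ #|A| * (A \subset S)%:R * (A \subset S')%:R).
    apply: eq_bigr => S; rewrite inE => /andP[sS _]; apply: eq_bigr => S' _.
    rewrite expr_card_subsets big_mkcond [RHS]big_mkcond.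
    apply: eq_bigr => A _; rewrite subsetI.
    have [sAS|] := boolP (A \subset S); last by rewrite /= mulr0 mul0r if_same.
    by rewrite (subset_trans sAS sS) mulr1 /=; case: ifP; rewrite ?mulr1 ?mulr0.
  under eq_bigr do rewrite exchange_big /=.
  rewrite exchange_big /=; apply: eq_bigr => A _.
  rewrite expr2 big_distrlr mulr_sumr; apply: eq_bigr => S _.
  by rewrite mulr_sumr; apply: eq_bigr => S' _; rewrite mulrA.
(* The guard matters: for [t > k] truncated subtraction would give ['C(m - t, 0) = 1], whereas no
   [k]-set contains a [t]-set. *)
pose G (t : nat) : R := if (t <= k)%N then (z - 1) ^+ t * 'C(m - t, k - t)%:R ^+ 2 else 0.
rewrite (eq_bigr (fun A : {set T} => G #|A|)) => [|A sAB]; last first.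
  rewrite /G; case: leqP => Ak.
    congr (_ * _ ^+ 2); rewrite -card_superset_draws //.
    rewrite /c -natr_sum -big_mkcondr sum1_card.
    by congr _%:R; apply: eq_card => S; rewrite unfold_in !inE.
  rewrite /c big1 ?expr0n ?mulr0 // => S; rewrite inE => /andP[_ /eqP cS].
  by case: (boolP (A \subset S)) => // /subset_leq_card; lia.
rewrite sum_expr_card_subsets -/m exprDn mulr_sumr.
rewrite (big_ord_widen m.+1 (fun t => 'C(m, k)%:R ^+ 2 *
  (1 ^+ (k - t) * (k%:R / m%:R * (z - 1)) ^+ t *+ 'C(k, t)))) ?ltnS //.
rewrite [leRHS]big_mkcond; apply: ler_sum => t _; rewrite /G ltnS.
case: leqP => [tk|]; last by rewrite mul0rn.
have tkm : (t <= k <= m)%N by rewrite tk.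
have -> : ((z - 1) ^+ t * 'C(m - t, k - t)%:R ^+ 2) *+ 'C(m, t) =
   ('C(m, k)%:R * 'C(k, t)%:R * (z - 1) ^+ t) * 'C(m - t, k - t)%:R.
  by rewrite -natrM -bin_mul_sub // natrM -mulr_natr; ring.
have -> : 'C(m, k)%:R ^+ 2 * (1 ^+ (k - t) * (k%:R / m%:R * (z - 1)) ^+ t *+ 'C(k, t)) =
   ('C(m, k)%:R * 'C(k, t)%:R * (z - 1) ^+ t) * ('C(m, k)%:R * k%:R ^+ t / m%:R ^+ t) :> R.
  by rewrite expr1n mul1r -mulr_natr !exprMn exprVn; ring.
apply: ler_wpM2l; first by rewrite !mulr_ge0 ?exprn_ge0 ?subr_ge0.
by rewrite ler_pdivlMr ?exprn_gt0 // -!natrX -!natrM ler_nat bin_sub_ratio.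
Qed.

End SubsetCounting.

(** * Moments of the number of alternative explanations under the Bernoulli design *)

Section BernoulliDesign.
Import boot.fintype boot.finset.
Set Implicit Arguments.
Unset Strict Implicit.
Variables (R : realType) (p : nat) (q : R).

Let row_mean (F : {ffun 'I_p -> bool} -> R) : R :=
  \sum_(x : {ffun 'I_p -> bool}) (\prod_j bernoulli_pmf q (x j)) * F x.

(** Independence of the rows: with matrices reindexed as functions from tests to rows, this is
    distributivity of product over sum. *)
Lemma mean_prod_rows (n : nat) (F : {ffun 'I_p -> bool} -> R) :
  \sum_(X : test_matrix n p)
      iid_bernoulli_pmf q X * \prod_i F [ffun j => X i j] = row_mean F ^+ n.
Proof.
have -> : row_mean F ^+ n = \prod_(i < n) row_mean F by rewrite prodr_const card_ord.
rewrite bigA_distr_bigA /=.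
pose row_ffun := {ffun 'I_n -> {ffun 'I_p -> bool}}.
rewrite (reindex (fun X : test_matrix n p =>
  [ffun i => [ffun j => X i j]] : row_ffun)) /=; last first.
  exists (fun f : row_ffun => \matrix_(i, j) f i j) => [X _|f _].
    by apply/matrixP => i j; rewrite !mxE !ffunE.
  by apply/ffunP => i; apply/ffunP => j; rewrite !ffunE mxE.
apply: eq_bigr => X _.
rewrite -big_split /=; apply: eq_bigr => i _; rewrite ffunE.
by congr (_ * _); apply: eq_bigr => j _; rewrite ffunE.
Qed.

Definition positive (A : {set 'I_p}) (x : {ffun 'I_p -> bool}) :=
  \big[orb/false]_(j in A) x j.

Lemma positiveU A B x : positive (A :|: B) x = positive A x || positive B x.
Proof.
rewrite /positive !big_orE; apply/existsP/orP => [[j /andP[]]|].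
  by rewrite inE => /orP[] jA xj; [left | right]; apply/existsP; exists j; rewrite jA.
by case=> /existsP[j /andP[jA xj]]; exists j; rewrite inE jA ?orbT.
Qed.

(** The indicator factors over the items; an item contributes [1 - q] if it lies in [A] and 1
    otherwise. *)
Lemma row_mean_negative A :
  row_mean (fun x => (~~ positive A x)%:R) = (1 - q) ^+ #|A|.
Proof.
have negE x : (~~ positive A x)%:R = \prod_j ((j \in A) ==> ~~ x j)%:R :> R.
  rewrite /positive big_orE negb_exists.
  case: (boolP [forall _, _]) => [/forallP H|].
    by rewrite big1 // => j _; have := H j; rewrite negb_and -implybE => ->.
  rewrite negb_forall => /existsP[j]; rewrite negbK => /andP[jA xj].
  by rewrite (bigD1 j) //= jA xj mul0r.
rewrite /row_mean; under eq_bigr do rewrite negE -big_split /=.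
rewrite -(bigA_distr_bigA (fun j b => bernoulli_pmf q b * ((j \in A) ==> ~~ b)%:R)) /=.
rewrite -prodr_const [RHS]big_mkcond /=; apply: eq_bigr => j _.
rewrite big_bool /bernoulli_pmf /=.
by case: (j \in A) => /=; ring.
Qed.

Lemma row_mean_true : row_mean (fun=> 1) = 1.
Proof.
(* Total mass 1 is the case of the empty set, which is always negative. *)
rewrite -[RHS](expr0 (1 - q)) -(cards0 'I_p) -row_mean_negative.
by rewrite /row_mean; apply: eq_bigr => x _; rewrite /positive big_set0.
Qed.

(** With [a] and [b] the indicators that [A] and [B] are negative, agreement has indicator
    [1 - a - b + 2 * a * b], and [a * b] is the indicator for the union. *)
Lemma row_mean_agree2 A B : A :&: B = set0 ->
  row_mean (fun x => (positive A x == positive B x)%:R) =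
  1 - (1 - q) ^+ #|A| - (1 - q) ^+ #|B| + 2 * (1 - q) ^+ (#|A| + #|B|).
Proof.
move=> AB0; have -> : (#|A| + #|B| = #|A :|: B|)%N by rewrite cardsU AB0 cards0 subn0.
rewrite -!row_mean_negative.
rewrite -[X in X - row_mean (fun x => (~~ positive A x)%:R) - _]row_mean_true.
rewrite /row_mean mulr_sumr -!sumrN -!big_split /=; apply: eq_bigr => x _.
by rewrite positiveU; case: (positive A x); case: (positive B x) => /=; ring.
Qed.

(* The events "A, B, C all positive" and "A, B, C all negative" contribute
   opposite cubic terms, so only pairwise unions remain. *)
Lemma row_mean_agree3 A B C :
  row_mean (fun x => (positive A x == positive C x)%:R *
                     (positive B x == positive C x)%:R) =
  1 - (1 - q) ^+ #|A| - (1 - q) ^+ #|B| - (1 - q) ^+ #|C| +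
  (1 - q) ^+ #|A :|: B| + (1 - q) ^+ #|A :|: C| + (1 - q) ^+ #|B :|: C|.
Proof.
rewrite -!row_mean_negative.
rewrite -[X in X - row_mean (fun x => (~~ positive A x)%:R) - _ - _]row_mean_true.
rewrite /row_mean -!sumrN -!big_split /=; apply: eq_bigr => x _.
rewrite !positiveU.
by case: (positive A x); case: (positive B x); case: (positive C x) => /=; ring.
Qed.

Lemma outcome_eqE (n : nat) A B (X : test_matrix n p) :
  (outcome A X == outcome B X)%:R =
  \prod_i (positive A [ffun j => X i j] == positive B [ffun j => X i j])%:R :> R.
Proof.
have rowE D i : outcome D X i ord0 = positive D [ffun j => X i j].
  by rewrite mxE; apply: eq_bigr => j _; rewrite ffunE.
case: eqP => [e|ne].
  by rewrite big1 // => i _; rewrite -!rowE e eqxx.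
apply/esym/eqP; rewrite prodf_seq_eq0; apply/hasP.
have /existsP[i ni] : [exists i, outcome A X i ord0 != outcome B X i ord0].
  apply: contra_notT ne; rewrite negb_exists => /forallP H.
  by apply/matrixP => i j; rewrite ord1; apply/eqP; have := H i; rewrite negbK.
by exists i; rewrite ?mem_index_enum //= -!rowE (negbTE ni).
Qed.

Section Moments.
Variables (n k : nat) (K : {set 'I_p}).
Hypotheses (cK : #|K| = k) (hq : (1 - q) ^+ k = 1 / 2).

Let P : {set {set 'I_p}} := [set S : {set 'I_p} | (S \subset ~: K) & #|S| == k]%SET.

(** The count [N], written as a real sum of indicators so that its square expands over pairs of
    sets. *)
Definition disjoint_explanations (X : test_matrix n p) : R :=
  \sum_(S in P) (outcome S X == outcome K X)%:R.

Lemma iid_bernoulli_pmf_sum1 : \sum_(X : test_matrix n p) iid_bernoulli_pmf q X = 1.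
Proof.
rewrite -[RHS](expr1n _ n) -row_mean_true -mean_prod_rows.
by apply: eq_bigr => X _; rewrite big1 ?mulr1.
Qed.

Lemma mean_disjoint_explanations :
  \sum_X iid_bernoulli_pmf q X * disjoint_explanations X =
  'C(p - k, k)%:R * 2^-1 ^+ n.
Proof.
under eq_bigr do rewrite mulr_sumr.
rewrite exchange_big /= (eq_bigr (fun=> 2^-1 ^+ n)) => [|S].
  rewrite big_const iter_addr_0 mulr_natl; congr (_ *+ _).
  by rewrite cards_draws cardsCs setCK card_ord cK.
rewrite inE -disjoints_subset => /andP[/disjoint_setI0 SK0 /eqP cS].
under eq_bigr do rewrite outcome_eqE.
rewrite (mean_prod_rows n (fun x => (positive S x == positive K x)%:R)).
(* Each test contributes [1 - 1/2 - 1/2 + 2 * 1/4 = 1/2]. *)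
rewrite row_mean_agree2 // cS cK exprD hq.
by congr (_ ^+ _); field.
Qed.

Lemma mean_disjoint_explanations_sqr :
  \sum_X iid_bernoulli_pmf q X * disjoint_explanations X ^+ 2 =
  4^-1 ^+ n * \sum_(S in P) \sum_(S' in P) ((1 - q) ^- n) ^+ #|S :&: S'|.
Proof.
under eq_bigr do rewrite expr2 big_distrlr mulr_sumr /=.
rewrite exchange_big mulr_sumr; apply: eq_bigr => S.
rewrite inE -disjoints_subset => /andP[/disjoint_setI0 SK0 /eqP cS].
under eq_bigr do rewrite mulr_sumr.
rewrite exchange_big mulr_sumr; apply: eq_bigr => S'.
rewrite inE -disjoints_subset => /andP[/disjoint_setI0 SK0' /eqP cS'].
under eq_bigr do rewrite !outcome_eqE -big_split.
rewrite (mean_prod_rows n (fun x =>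
  (positive S x == positive K x)%:R * (positive S' x == positive K x)%:R)).
(* With [u = 1 - q] and overlap [l], each test contributes [1 - 3/2 + u ^ (2 k - l) + 1/4 + 1/4],
   that is [u ^ (- l) / 4]. *)
rewrite row_mean_agree3 !cardsU SK0 SK0' cards0 cS cS' cK !subn0 !exprD hq.
have lk : (#|S :&: S'| <= k)%N by rewrite -cS subset_leq_card ?subsetIl.
have u0 : 1 - q != 0.
  (* A zero base would make the power 0 or 1, never [1 / 2]. *)
  apply/eqP => u0; move: hq; rewrite u0 expr0n; case: (k) => [|?] /=; lra.
rewrite -exprVn -exprM mulnC exprM -exprMn; congr (_ ^+ _).
rewrite -addnBA // exprD expfB_cond ?(negbTE u0) // hq exprVn.
by field; rewrite expf_neq0.
Qed.

End Moments.
End BernoulliDesign.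

(** * Decoders without false claims *)

Section Decoding.
Import boot.fintype boot.finset.
Set Implicit Arguments.
Unset Strict Implicit.
Variables (R : realType) (n p k : nat) (nu : R) (D : decoder R n p).
Hypothesis hq : 0 <= nu / k%:R <= 1.

Lemma iid_bernoulli_pmf_ge0 (q : R) (X : test_matrix n p) :
  0 <= q <= 1 -> 0 <= iid_bernoulli_pmf q X.
Proof.
move=> /andP[q0 q1]; do 2 (apply: prodr_ge0 => ? _).
by rewrite /bernoulli_pmf; case: ifP; rewrite ?subr_ge0.
Qed.

Lemma group_testing_pmf_ge0 w : 0 <= group_testing_pmf k nu D w.
Proof.
case: w => [[K X] i] /=; rewrite !mulr_ge0 ?iid_bernoulli_pmf_ge0 ?decoder_ge0 //.
by rewrite /defective_pmf; case: ifP; rewrite ?invr_ge0.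
Qed.

Lemma group_testing_probE (E : pred (sample n p)) :
  group_testing_prob k nu D E =
  \sum_K \sum_X \sum_(i | E (K, X, i)) group_testing_pmf k nu D (K, X, i).
Proof.
rewrite (pair_bigA _ (fun K X =>
  \sum_(i | E (K, X, i)) group_testing_pmf k nu D (K, X, i))) /=.
rewrite pair_big_dep /=.
by apply: eq_big => [[[K X] i]|[[K X] i]].
Qed.

Lemma defective_pmf_sum1 : (k <= p)%N -> \sum_K @defective_pmf R p k K = 1.
Proof.
move=> kp; rewrite /defective_pmf -big_mkcond sumr_const -[#|_|](_ : 'C(p, k) = _).
  by rewrite -[_ *+ _]mulr_natr mulVf // pnatr_eq0 -lt0n bin_gt0.
by rewrite -{1}(card_ord p) -card_draws cardsE.
Qed.

Lemma dont_know_le1 : (k <= p)%N -> group_testing_prob k nu D (@dont_know n p) <= 1.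
Proof.
move=> kp.
have <- : group_testing_prob k nu D xpredT = 1.
  rewrite group_testing_probE -[RHS](defective_pmf_sum1 kp); apply: eq_bigr => K _.
  rewrite -[RHS]mulr1 -(iid_bernoulli_pmf_sum1 p (nu / k%:R) n) mulr_sumr.
  by apply: eq_bigr => X _; rewrite -mulr_sumr decoder_sum1 mulr1.
rewrite /group_testing_prob big_mkcond; apply: ler_sum => w _.
by case: ifP => // _; exact: group_testing_pmf_ge0.
Qed.

Hypothesis hfalse : group_testing_prob k nu D (@false_claim n p) = 0.

(** A sum of nonnegative weights that vanishes has only zero terms; for a false claim on [S], the
    prior and the design weight are nonzero, so the decoder's factor is the one that vanishes. *)
Lemma claimed_in_explanation (S : {set 'I_p}) (X : test_matrix n p) (j : 'I_p) :
  #|S| = k -> iid_bernoulli_pmf (nu / k%:R) X != 0 ->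
  D X (outcome S X) (lift ord0 j) != 0 -> j \in S.
Proof.
move=> cS X0; apply: contraNT => jS.
have claim : false_claim (S, X, lift ord0 j).
  by rewrite /false_claim /= mem_imset //; exact: lift_inj.
have /eqP := psumr_eq0P (fun w _ => group_testing_pmf_ge0 w) hfalse claim.
rewrite !mulf_eq0 (negbTE X0) orbF /defective_pmf cS eqxx invr_eq0.
rewrite pnatr_eq0 -leqn0 leqNgt bin_gt0.
by have -> : (k <= p)%N by rewrite -cS -[leqRHS](card_ord p) max_card.
Qed.

(** The decoder sees the defective set only through the outcome, so a claimed item would lie in both
    [K] and [S]; all the mass is left at [ord0]. *)
Lemma dont_know_of_disjoint_explanations (K S : {set 'I_p}) (X : test_matrix n p) :
  #|K| = k -> #|S| = k -> K :&: S = set0 -> outcome S X = outcome K X ->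
  iid_bernoulli_pmf (nu / k%:R) X != 0 -> D X (outcome K X) ord0 = 1.
Proof.
move=> cK cS KS0 e X0; rewrite -(decoder_sum1 D X (outcome K X)) (bigD1 ord0) //=.
rewrite big1 ?addr0 // => i; case: (unliftP ord0 i) => [j -> _|->]; last by rewrite eqxx.
apply/eqP; apply: contraT => ne.
have jK := claimed_in_explanation cK X0 ne.
have jS : j \in S by apply: (claimed_in_explanation cS X0); rewrite e.
by have := in_set0 j; rewrite -KS0 inE jK jS.
Qed.

Lemma dont_know_ge : (0 < k)%N -> (k.*2 <= p)%N -> (1 - nu / k%:R) ^+ k = 1 / 2 ->
  2 - (1 + k%:R / (p - k)%:R * ((1 - nu / k%:R) ^- n - 1)) ^+ k <=
  group_testing_prob k nu D (@dont_know n p).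
Proof.
set q := nu / k%:R; move=> k0 kp hqk.
have /andP[q0 q1] := hq; rewrite -/q in q0 q1.
have q1' : q < 1.
  rewrite lt_neqAle q1 andbT; apply/eqP => q1E; move: hqk.
  by rewrite q1E subrr expr0n gtn_eqF //= => h; lra.
have z1 : 1 <= (1 - q) ^- n.
  by rewrite invf_ge1 ?exprn_gt0 ?exprn_ile1 //; lra.
pose mu : R := 'C(p - k, k)%:R * 2^-1 ^+ n.
have C0 : 0 < 'C(p - k, k)%:R :> R by rewrite ltr0n bin_gt0; lia.
have mu0 : 0 < mu by rewrite mulr_gt0 ?exprn_gt0.
rewrite group_testing_probE; set b := leLHS.
have kp' : (k <= p)%N by lia.
rewrite -[b]mul1r -(defective_pmf_sum1 kp') mulr_suml; apply: ler_sum => K _.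
rewrite /group_testing_pmf -/q; case: (eqVneq #|K| k) => [cK|cK]; last first.
  rewrite /defective_pmf (negbTE cK) mul0r big1 // => X _.
  by rewrite big1 // => i _; rewrite !mul0r.
have d0 : 0 <= defective_pmf k K :> R.
  by rewrite /defective_pmf; case: ifP; rewrite ?invr_ge0.
under eq_bigr do under eq_bigr do rewrite -mulrA.
under eq_bigr do rewrite -mulr_sumr.
rewrite -mulr_sumr ler_wpM2l //.
pose N := @disjoint_explanations R p n k K.
have EN : \sum_X iid_bernoulli_pmf q X * N X = mu := mean_disjoint_explanations n cK hqk.
have EN2 : \sum_X iid_bernoulli_pmf q X * N X ^+ 2 <=
    mu ^+ 2 * (1 + k%:R / (p - k)%:R * ((1 - q) ^- n - 1)) ^+ k.
  rewrite (mean_disjoint_explanations_sqr n cK hqk).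
  have cKc : #|~: K| = (p - k)%N by rewrite cardsCs setCK card_ord cK.
  have := @sum_expr_card_setI R _ (~: K) k _ z1; rewrite cKc => /(_ ltac:(lia)) H.
  rewrite {1}/mu exprMn -exprM mulnC exprM (_ : 2^-1 ^+ 2 = 4^-1 :> R); last by field.
  by rewrite -[leRHS]mulrA [leRHS]mulrCA ler_wpM2l ?exprn_ge0.
(* Chebyshev in pointwise form: the indicator of [N > 0] is at least [1 - (N / mu - 1) ^+ 2], whose
   mean is [2 - E[N ^ 2] / mu ^ 2]. *)
apply: (@le_trans _ _ (\sum_X iid_bernoulli_pmf q X * (1 - (N X / mu - 1) ^+ 2))).
  have -> : \sum_X iid_bernoulli_pmf q X * (1 - (N X / mu - 1) ^+ 2) =
     2 / mu * (\sum_X iid_bernoulli_pmf q X * N X) -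
     mu ^- 2 * (\sum_X iid_bernoulli_pmf q X * N X ^+ 2).
    rewrite !mulr_sumr -sumrB; apply: eq_bigr => X _; field; lra.
  rewrite EN divfK ?gt_eqF // /b lerD2l lerN2 -/q.
  by rewrite ler_pdivrMl ?exprn_gt0.
apply: ler_sum => X _.
rewrite (big_pred1 ord0) => [|i //].
(* On matrices of probability zero the absence of false claims says nothing about the decoder. *)
have [->|X0] := eqVneq (iid_bernoulli_pmf q X) 0; first by rewrite !mul0r.
rewrite ler_wpM2l ?iid_bernoulli_pmf_ge0 ?q0 //.
have [N0|N0] := eqVneq (N X) 0.
  by rewrite N0 mul0r sub0r sqrrN expr1n subrr decoder_ge0.
have /existsP[S /andP[SP /eqP e]] : [exists S : {set 'I_p},
    ((S \subset ~: K) && (#|S| == k)) && (outcome S X == outcome K X)].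
  apply: contraNT N0; rewrite negb_exists => /forallP noS.
  apply/eqP/big1 => S; rewrite inE => SP.
  by have := noS S; rewrite SP /= => /negbTE ->.
have /andP[] := SP; rewrite -disjoints_subset disjoint_sym.
move=> /disjoint_setI0 KS0 /eqP cS.
rewrite (dont_know_of_disjoint_explanations cK cS KS0 e X0).
by rewrite gerBl sqr_ge0.
Qed.

End Decoding.

(** * Exponential bounds on binomials and on the overlap moment *)

Section Asymptotics.
Set Implicit Arguments.
Unset Strict Implicit.
Variable R : realType.

Lemma ffact_le_exp (n m : nat) : (n ^_ m <= n ^ m)%N.
Proof.
elim: m n => [|m IH] n //; rewrite ffactnS expnS leq_mul //.
by apply: leq_trans (IH _) _; case: m {IH} => // m; rewrite leq_exp2r // leq_pred.
Qed.

(** The quotient of [k ^ k] by the factorial of [k] is one term of the exponential series at [k]. *)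
Lemma expn_le_fact_expR (k : nat) : (k%:R : R) ^+ k <= k`!%:R * expR k%:R.
Proof.
case: k => [|k]; first by rewrite expr0 fact0 mul1r expR0.
rewrite mulrC -ler_pdivrMr ?ltr0n ?fact_gt0 //.
have := @expR_ge1Dxn R k.+1%:R k (ler0n _ _); lra.
Qed.

Lemma ln_bin_le (p k : nat) : (0 < k <= p)%N ->
  ln ('C(p, k)%:R : R) <= k%:R * (1 + ln p%:R - ln k%:R).
Proof.
move=> /andP[k0 kp].
have kR : 0 < k%:R :> R by rewrite ltr0n.
have pR : 0 < p%:R :> R by rewrite ltr0n; lia.
have C0 : 0 < 'C(p, k)%:R :> R by rewrite ltr0n bin_gt0.
have f0 : 0 < k`!%:R :> R by rewrite ltr0n fact_gt0.
have H1 : 'C(p, k)%:R * k`!%:R <= p%:R ^+ k :> R.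
  by rewrite -natrM bin_ffact -natrX ler_nat ffact_le_exp.
have H2 : 'C(p, k)%:R * k%:R ^+ k <= p%:R ^+ k * expR k%:R :> R.
  rewrite -(ler_pM2r f0).
  apply: (@le_trans _ _ (('C(p, k)%:R * k`!%:R) * (k`!%:R * expR k%:R))).
    by rewrite mulrAC ler_wpM2l ?expn_le_fact_expR ?mulr_ge0 ?ler0n.
  by rewrite -[leRHS]mulrA [expR _ * _]mulrC ler_wpM2r ?mulr_ge0 ?expR_ge0 ?ler0n.
have := H2; rewrite -ler_ln ?posrE ?mulr_gt0 ?exprn_gt0 ?expR_gt0 //.
rewrite !lnM ?posrE ?exprn_gt0 ?expR_gt0 // !lnXn // expRK => h.
rewrite -[ln p%:R *+ _]mulr_natl -[ln k%:R *+ _]mulr_natl in h.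
by rewrite mulrBr mulrDr mulr1 lerBrDr [leRHS]addrC.
Qed.

Lemma overlap_moment_le (eta eps q : R) (p k n : nat) :
  0 < eta < 1 -> 0 < eps <= 1 -> (0 < k)%N -> (k.*2 <= p)%N ->
  0 <= q <= 1 -> (1 - q) ^+ k = 1 / 2 ->
  n%:R <= (1 - eta) * log2 ('C(p, k)%:R : R) ->
  k%:R <= eps * p%:R `^ (eta / (1 + eta)) ->
  (1 + k%:R / (p - k)%:R * ((1 - q) ^- n - 1)) ^+ k <= expR (2 * expR 1 * eps).
Proof.
move=> /andP[eta0 eta1] /andP[eps0 eps1] k0 kp.
have k0p : (0 < k <= p)%N by lia.
have pk0 : (0 < p - k)%N by lia.
(* Source of the factor 2 in the final exponent. *)
have pm : p%:R <= 2 * (p - k)%:R :> R by rewrite -natrM ler_nat; lia.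
move=> /andP[q0 q1] hq hn hk.
have kR : 0 < k%:R :> R by rewrite ltr0n.
have pR : 0 < p%:R :> R by rewrite ltr0n; case/andP: k0p; apply: leq_trans.
have ln2 : 0 < ln 2 :> R by rewrite ln_gt0 ?ltr1n.
have u0 : 0 < 1 - q.
  rewrite lt_neqAle subr_ge0 q1 andbT; apply/eqP => u0.
  by move: hq; rewrite -u0 expr0n gtn_eqF //= => h; lra.
have z0 : 0 < (1 - q) ^- n by rewrite invr_gt0 exprn_gt0.
have z1 : 1 <= (1 - q) ^- n by rewrite invf_ge1 ?exprn_gt0 ?exprn_ile1 //; lra.
set z := (1 - q) ^- n in z0 z1 *.
(* Logarithms in [hq] give [k * ln z = n * ln 2]; the bound on [n] and [ln_bin_le] then allow
   division by [k]. *)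
have lnz : ln z <= (1 - eta) * (1 + ln p%:R - ln k%:R).
  rewrite -(ler_pM2l kR).
  have -> : k%:R * ln z = n%:R * ln 2.
    rewrite /z lnV ?posrE ?exprn_gt0 // lnXn //.
    have := congr1 (@ln R) hq; rewrite lnXn // mul1r lnV ?posrE // => h.
    by rewrite -[ln 2]opprK -h !mulr_natl -!mulNrn -!mulrnA mulnC.
  apply: (@le_trans _ _ ((1 - eta) * ln ('C(p, k)%:R : R))).
    by move: hn; rewrite /log2 mulrA ler_pdivlMr.
  by rewrite mulrCA ler_wpM2l ?ln_bin_le ?subr_ge0 ?(ltW eta1).
clearbody z.
have lnk : (1 + eta) * ln k%:R <= (1 + eta) * ln eps + eta * ln p%:R.
  have : ln k%:R <= ln eps + eta / (1 + eta) * ln p%:R.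
    by rewrite -ln_powR -lnM ?posrE ?powR_gt0 // ler_ln ?posrE ?mulr_gt0 ?powR_gt0.
  rewrite -(ler_pM2l (_ : 0 < 1 + eta)); last by lra.
  have -> : (1 + eta) * (ln eps + eta / (1 + eta) * ln p%:R) =
    (1 + eta) * ln eps + eta * ln p%:R by field; lra.
  by [].
have lneps : ln eps <= 0 by exact: ln_le0.
(* In logarithms, [lnz] leaves [(1 + eta) * ln k - eta * ln p + (1 - eta)], and [lnk] bounds this by
   [(1 + eta) * ln eps + 1 - eta]. As [ln eps <= 0], this is at most [1 + ln eps]. *)
have kz : k%:R * (k%:R * z) / p%:R <= expR 1 * eps.
  rewrite -ler_ln ?posrE ?mulr_gt0 ?invr_gt0 ?expR_gt0 //.
  rewrite ln_div ?posrE ?mulr_gt0 // !lnM ?posrE ?mulr_gt0 ?expR_gt0 // expRK.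
  nra.
have mR : 0 < (p - k)%:R :> R by rewrite ltr0n.
apply: (@le_trans _ _ (expR (k%:R / (p - k)%:R * (z - 1)) ^+ k)).
  rewrite lerXn2r ?nnegrE ?expR_ge0 ?expR_ge1Dx //.
  by rewrite addr_ge0 ?mulr_ge0 ?invr_ge0 ?subr_ge0 ?ler0n.
rewrite -expRM_natl ler_expR.
rewrite -(ler_pM2r mR).
have -> : k%:R * (k%:R / (p - k)%:R * (z - 1)) * (p - k)%:R = k%:R * (k%:R * z) - k%:R * k%:R.
  by field; lra.
rewrite ler_pdivrMr // in kz.
have ee : 0 <= expR 1 * eps by rewrite mulr_ge0 ?expR_ge0 ?ltW.
have kk : 0 <= k%:R * k%:R :> R by rewrite mulr_ge0 ?ltW.
have := ler_wpM2l ee pm.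
lra.
Qed.

End Asymptotics.

Theorem theorem7 (R : realType) (eta : R) (k n : nat -> nat) (nu : nat -> R)
    (D : forall p : nat, decoder R (n p) p)
    (heta : 0 < eta < 1)
    (hk : forall p : nat, (0 < p)%N -> (1 <= k p <= p)%N)
    (hbern : forall p : nat, (0 < p)%N -> 0 <= nu p / (k p)%:R <= 1)
    (hnu : forall p : nat, (0 < p)%N ->
      (1 - nu p / (k p)%:R) ^+ k p = 1 / 2)
    (hn : forall p : nat, (0 < p)%N ->
      (n p)%:R <= (1 - eta) * log2 ('C(p, k p)%:R : R))
    (hko : (fun p : nat => (k p)%:R : R)
      =o_\oo (fun p : nat => (p%:R : R) `^ (eta / (1 + eta))))
    (hzero : forall p : nat, (0 < p)%N ->
      group_testing_prob (k p) (nu p) (D p) (@false_claim (n p) p) = 0) :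
  (fun p : nat => group_testing_prob (k p) (nu p) (D p) (@dont_know (n p) p))
    @ \oo --> (1 : R).
Proof.
have /andP[eta0 eta1] := heta.
apply/cvgrPdist_le => delta delta0.
(* The first bound forces [2 k <= p]; the second makes [expR (2 * expR 1 * eps)] at most
   [1 + delta]. *)
pose eps : R := Num.min (1 / 2) (ln (1 + delta) / (2 * expR 1)).
have e0 : 0 < 2 * expR 1 :> R by rewrite mulr_gt0 ?expR_gt0.
have eps0 : 0 < eps.
  rewrite /eps lt_min divr_gt0 //= divr_gt0 // ln_gt0 //; lra.
have eps_half : eps <= 1 / 2 by rewrite /eps ge_min lexx.
have expR_eps : expR (2 * expR 1 * eps) <= 1 + delta.
  rewrite -[leRHS]lnK ?posrE; last by lra.
  by rewrite ler_expR mulrC -ler_pdivlMr // /eps ge_min lexx orbT.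
have /eqoP/(_ _ eps0) := hko.
apply: filterS2 (nbhs_infty_ge 1) => p p0 kp.
rewrite !ger0_norm ?powR_ge0 ?ler0n // in kp.
have /andP[k0 k_le_p] := hk p p0.
have k2p : ((k p).*2 <= p)%N.
  rewrite -(ler_nat R) -muln2 natrM.
  have : p%:R `^ (eta / (1 + eta)) <= p%:R :> R.
    apply: ler1_powR; rewrite ?ler1n //.
    by rewrite ler_pdivrMr; lra.
  have := powR_ge0 (p%:R : R) (eta / (1 + eta)).
  nra.
have eps01 : 0 < eps <= 1 by rewrite eps0; lra.
have lower := dont_know_ge (hbern p p0) (hzero p p0) k0 k2p (hnu p p0).
have upper := overlap_moment_le heta eps01 k0 k2p (hbern p p0) (hnu p p0) (hn p p0) kp.
have le1 := dont_know_le1 (D p) (hbern p p0) k_le_p.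
(* The probability lies between [2 - (1 + delta)] and 1. *)
rewrite ger0_norm ?subr_ge0 //; lra.
Qed.
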